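(* Let $\Pi X.\,s\,[\exists\vec{x}.\varphi]$ and $\Pi Y.\,t\,[\exists\vec{y}.\psi]$ be existentially constrained terms and $\rho$ a left-linear constrained rewrite rule. If $\Pi X.\,s\,[\exists\vec{x}.\varphi]\leadsto_\rho \Pi Y.\,t\,[\exists\vec{y}.\psi]$, then there exist existentially constrained terms $A$ and $B$ such that $A\precsim \Pi X.\,s\,[\exists\vec{x}.\varphi]$, $A\to_\rho B$, and $B\sim \Pi Y.\,t\,[\exists\vec{y}.\psi]$.
   Context: Terms are built over a sorted signature whose function symbols are split into theory symbols (whose argument and result sorts are theory sorts) and term symbols, and a set $\mathcal{V}$ of sorted variables; theory sorts and symbols are interpreted in a fixed model $\mathcal{M}$. Every element of the interpretation of each theory sort is a constant symbol, called a value; $\mathcal{V}al$ denotes the set of values. There is a theory sort of Booleans with standard interpretation and the usual connectives. A constraint is a Boolean-sorted term built from theory symbols and variables; a (possibly existentially quantified) formula is valid if it is true under all valuations of its free variables in $\mathcal{M}$ and satisfiable if true under some. $\mathcal{V}ar(\cdot)$ is the set of variables. A substitution $\sigma$ is a sort-preserving map from variables to terms with finite domain $\mathcal{D}om(\sigma)=\{x\mid \sigma(x)\neq x\}$; $\sigma$ is $X$-valued if $\sigma(X)\subseteq\mathcal{V}al$. An existential constraint $\exists\vec{x}.\varphi$ is a sequence of variables $\vec x$ together with a constraint $\varphi$ with $\{\vec x\}\subseteq\mathcal{V}ar(\varphi)$; its free variables are $\mathcal{FV}ar(\exists\vec x.\varphi)=\mathcal{V}ar(\varphi)\setminus\{\vec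 x\}$. For a substitution $\sigma$, $\sigma\vDash_{\mathcal M}\exists\vec x.\varphi$ means $\sigma$ is $\mathcal{FV}ar(\exists\vec x.\varphi)$-valued and $(\exists\vec x.\varphi)\sigma$ is valid. An existentially constrained term $\Pi X.\,s\,[\exists\vec x.\varphi]$ consists of a set $X$ of variables, a term $s$ and an existential constraint with $\mathcal{FV}ar(\exists\vec x.\varphi)\subseteq X\subseteq\mathcal{V}ar(s)$ and $\{\vec x\}\cap\mathcal{V}ar(s)=\emptyset$; it is satisfiable if $\exists\vec x.\varphi$ is satisfiable. Subsumption: $\Pi X.\,s\,[\exists\vec x.\varphi]\precsim\Pi Y.\,t\,[\exists\vec y.\psi]$ holds if for every $X$-valued substitution $\sigma$ with $\sigma\vDash_{\mathcal M}\exists\vec x.\varphi$ there is a $Y$-valued substitution $\gamma$ with $\gamma\vDash_{\mathcal M}\exists\vec y.\psi$ and $s\sigma=t\gamma$. Equivalence $\sim$ means subsumption in both directions. A constrained rewrite rule $\rho\colon \Pi Z.\,\ell\to r\,[\pi]$ consists of a set $Z$ of variables, terms $\ell,r$ of the same sort and a constraint $\pi$ with $\mathcal{V}ar(\pi)\cup(\mathcal{V}ar(r)\setminus\mathcal{V}ar(\ell))\subseteq Z$; it is left-linear if $\ell$ is linear; $\mathcal{E}x\mathcal{V}ar(\rho)=\mathcal{V}ar(r)\setminus\mathcal{V}ar(\ell)$. Let $\Pi X.\,s\,[\exists\vec x.\varphi]$ be satisfiable, $\rho$ left-linear with $\mathcal{V}ar(\rho)\cap\mathcal{V}ar(s,\varphi)=\emptyset$,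 and $\{\vec z\}=\mathcal{V}ar(\pi)\setminus\mathcal{V}ar(\ell)$. The term has a $\rho$-redex at position $p$ of $s$ using $\gamma$ if (i) $\mathcal{D}om(\gamma)=\mathcal{V}ar(\ell)$, (ii) $s|_p=\ell\gamma$, (iii) $\gamma(x)\in\mathcal{V}al\cup X$ for all $x\in\mathcal{V}ar(\ell)\cap Z$, and (iv) $(\exists\vec x.\varphi)\Rightarrow(\exists\vec z.\pi\gamma)$ is valid; it has a partial $\rho$-redex at $p$ using $\gamma$ if (i)–(iii) hold and (iv') $(\exists\vec x.\varphi)\wedge(\exists\vec z.\pi\gamma)$ is satisfiable. In either case put $t=s[r\gamma]_p$, $\psi=\varphi\wedge\pi\gamma$, $\{\vec y\}=\mathcal{V}ar(\psi)\setminus\mathcal{V}ar(t)$, $Y=\mathcal{E}x\mathcal{V}ar(\rho)\cup(X\cap\mathcal{V}ar(t))$. A $\rho$-redex yields a most general rewrite step $\Pi X.\,s\,[\exists\vec x.\varphi]\to^p_{\rho,\gamma}\Pi Y.\,t\,[\exists\vec y.\psi]$, and a partial $\rho$-redex yields a partial rewrite step $\Pi X.\,s\,[\exists\vec x.\varphi]\leadsto^p_{\rho,\gamma}\Pi Y.\,t\,[\exists\vec y.\psi]$. One writes $\to_\rho$ (resp. $\leadsto_\rho$) if such a step exists for some position, some $\gamma$ and some renamed variant of $\rho$ whose variables are disjoint from those of the source term. *)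

(* Defs.v *)
From mathcomp Require Import all_boot all_classical.

Set Implicit Arguments.
Unset Strict Implicit.
Unset Printing Implicit Defensive.

Local Open Scope classical_set_scope.

(* The interpretation of a theory sort [s] is the set of values of sort [s],   *)
(* i.e. of the symbols [v] with [value v] and [res v = s].  The interpretation *)
(* of the theory symbols is given by [model] below.                            *)
Record signature := Signature {
  sort : eqType;
  theory_sort : pred sort;
  fsym : Type;
  arg : fsym -> seq sort;
  res : fsym -> sort;
  theory_sym : pred fsym;
  theory_symP : forall f, theory_sym f ->
    all theory_sort (arg f) && theory_sort (res f);
  value : pred fsym;
  value_theory : forall v, value v -> theory_sym v;
  value_const : forall v, value v -> arg v = [::];
  sbool : sort;
  bval : bool -> fsym;
  bval_inj : injective bval;
  bval_value : forall b, value (bval b);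
  bval_res : forall b, res (bval b) = sbool;
  bval_surj : forall v, value v -> res v = sbool -> exists b, v = bval b;
  snot : fsym;
  sand : fsym;
  sor : fsym;
  simp : fsym;
  siff : fsym;
  snotP : [/\ theory_sym snot, arg snot = [:: sbool] & res snot = sbool];
  sandP : [/\ theory_sym sand, arg sand = [:: sbool; sbool] & res sand = sbool];
  sorP : [/\ theory_sym sor, arg sor = [:: sbool; sbool] & res sor = sbool];
  simpP : [/\ theory_sym simp, arg simp = [:: sbool; sbool] & res simp = sbool];
  siffP : [/\ theory_sym siff, arg siff = [:: sbool; sbool] & res siff = sbool];
  var : eqType;
  vsort : var -> sort;
  (* infinitely many variables of each sort, so that fresh renamings exist *)
  var_infinite : forall (s : sort) (xs : seq var),
    exists x, vsort x = s /\ x \notin xs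
}.

(* [interp f vs] is only constrained for theory symbols [f] and argument lists *)
(* [vs] of values of the right sorts.                                          *)
Record model (Sg : signature) := Model {
  interp : fsym Sg -> seq (fsym Sg) -> fsym Sg;
  interp_sort : forall f vs, theory_sym f -> all (@value Sg) vs ->
    map (@res Sg) vs = arg f ->
    value (interp f vs) /\ res (interp f vs) = res f;
  interp_value : forall v, value v -> interp v [::] = v;
  interp_not : forall a, interp (snot Sg) [:: bval Sg a] = bval Sg (~~ a);
  interp_and : forall a b,
    interp (sand Sg) [:: bval Sg a; bval Sg b] = bval Sg (a && b);
  interp_or : forall a b,
    interp (sor Sg) [:: bval Sg a; bval Sg b] = bval Sg (a || b);
  interp_imp : forall a b,
    interp (simp Sg) [:: bval Sg a; bval Sg b] = bval Sg (a ==> b);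
  interp_iff : forall a b,
    interp (siff Sg) [:: bval Sg a; bval Sg b] = bval Sg (a == b)
}.

(* Raw terms; the terms proper are those satisfying [well_sorted]. *)
Inductive term (Sg : signature) : Type :=
| Var of var Sg
| App of fsym Sg & seq (term Sg).

Arguments Var {Sg} _.
Arguments App {Sg} _ _.

Definition sort_of (Sg : signature) (t : term Sg) : sort Sg :=
  match t with Var x => vsort x | App f _ => res f end.

Fixpoint well_sorted (Sg : signature) (t : term Sg) : bool :=
  match t with
  | Var _ => true
  | App f ts => all (@well_sorted Sg) ts && (map (@sort_of Sg) ts == arg f)
  end.

(* the occurrences of variables, with multiplicity *)
Fixpoint vars (Sg : signature) (t : term Sg) : seq (var Sg) :=
  match t with
  | Var x => [:: x]
  | App _ ts => flatten (map (@vars Sg) ts)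
  end.

Definition varset (Sg : signature) (t : term Sg) : set (var Sg) :=
  [set x | x \in vars t].

Definition linear_term (Sg : signature) (t : term Sg) : Prop := uniq (vars t).

Definition is_val (Sg : signature) (t : term Sg) : Prop :=
  exists2 v : fsym Sg, value v & t = App v [::].

Fixpoint theory_term (Sg : signature) (t : term Sg) : bool :=
  match t with
  | Var _ => true
  | App f ts => theory_sym f && all (@theory_term Sg) ts
  end.

Definition is_constraint (Sg : signature) (t : term Sg) : Prop :=
  [/\ well_sorted t, theory_term t & sort_of t = sbool Sg].

Definition tand (Sg : signature) (t u : term Sg) : term Sg :=
  App (sand Sg) [:: t; u].

Fixpoint tsubst (Sg : signature) (sigma : var Sg -> term Sg) (t : term Sg) :
    term Sg :=
  match t with
  | Var x => sigma x
  | App f ts => App f (map (tsubst sigma) ts)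
  end.

Definition subst_dom (Sg : signature) (sigma : var Sg -> term Sg) :
    set (var Sg) :=
  [set x | sigma x <> Var x].

Record subst (Sg : signature) := Subst {
  subst_fun :> var Sg -> term Sg;
  subst_well_sorted : forall x, well_sorted (subst_fun x);
  subst_sort : forall x, sort_of (subst_fun x) = vsort x;
  subst_finite : finite_set (subst_dom subst_fun)
}.

Definition valued (Sg : signature) (X : set (var Sg)) (sigma : subst Sg) :
    Prop :=
  forall x, X x -> is_val (sigma x).

(* Positions are sequences of argument indices, counted from 0. *)
Fixpoint subterm_at (Sg : signature) (t : term Sg) (p : seq nat) :
    option (term Sg) :=
  match p with
  | [::] => Some t
  | i :: q =>
      if t is App _ ts then
        if onth ts i is Some u then subterm_at u q else None
      else None
  end.

(* [t] itself if [p] is not a position of [t] *)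
Fixpoint replace_at (Sg : signature) (t : term Sg) (p : seq nat) (w : term Sg) :
    term Sg :=
  match p with
  | [::] => w
  | i :: q =>
      if t is App f ts then
        if onth ts i is Some u then App f (set_nth u ts i (replace_at u q w))
        else t
      else t
  end.

Inductive formula (Sg : signature) : Type :=
| FConstr of term Sg
| FEx of seq (var Sg) & formula Sg
| FAnd of formula Sg & formula Sg
| FImp of formula Sg & formula Sg.

Fixpoint fvars (Sg : signature) (F : formula Sg) : set (var Sg) :=
  match F with
  | FConstr phi => varset phi
  | FEx xs G => fvars G `\` [set x | x \in xs]
  | FAnd G H | FImp G H => fvars G `|` fvars H
  end.

(* Bound variables are not renamed: this is the usual substitution whenever    *)
(* [sigma] maps the free variables of [F] to values (no capture is possible),  *)
(* which is the only use made of it, in [satisfies].                           *)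
Fixpoint fsubst (Sg : signature) (sigma : var Sg -> term Sg) (F : formula Sg) :
    formula Sg :=
  match F with
  | FConstr phi => FConstr (tsubst sigma phi)
  | FEx xs G => FEx xs (fsubst (fun x => if x \in xs then Var x else sigma x) G)
  | FAnd G H => FAnd (fsubst sigma G) (fsubst sigma H)
  | FImp G H => FImp (fsubst sigma G) (fsubst sigma H)
  end.

(* [a] restricts to a valuation of the variables in [X]; outside [X] its       *)
(* results are junk.                                                           *)
Definition valuation (Sg : signature) (X : set (var Sg))
    (a : var Sg -> fsym Sg) : Prop :=
  forall x, X x -> value (a x) /\ res (a x) = vsort x.

Fixpoint eval (Sg : signature) (M : model Sg) (a : var Sg -> fsym Sg)
    (t : term Sg) : fsym Sg :=
  match t with
  | Var x => a x
  | App f ts => interp M f (map (eval M a) ts)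
  end.

Fixpoint truth (Sg : signature) (M : model Sg) (a : var Sg -> fsym Sg)
    (F : formula Sg) : Prop :=
  match F with
  | FConstr phi => eval M a phi = bval Sg true
  | FEx xs G => exists b : var Sg -> fsym Sg,
      [/\ valuation [set x | x \in xs] b,
          forall x, x \notin xs -> b x = a x
        & truth M b G]
  | FAnd G H => truth M a G /\ truth M a H
  | FImp G H => truth M a G -> truth M a H
  end.

Definition valid (Sg : signature) (M : model Sg) (F : formula Sg) : Prop :=
  forall a, valuation (fvars F) a -> truth M a F.

Definition satisfiable (Sg : signature) (M : model Sg) (F : formula Sg) : Prop :=
  exists2 a, valuation (fvars F) a & truth M a F.

Definition satisfies (Sg : signature) (M : model Sg) (sigma : subst Sg)
    (F : formula Sg) : Prop :=
  valued (fvars F) sigma /\ valid M (fsubst sigma F).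

Definition exconstr (Sg : signature) (xs : seq (var Sg)) (phi : term Sg) :
    formula Sg :=
  FEx xs (FConstr phi).

(* [ECTerm X s xs phi _ .. _] is the existentially constrained term            *)
(* Pi X. s [exists xs. phi].                                                   *)
Record ecterm (Sg : signature) := ECTerm {
  ec_set : set (var Sg);
  ec_term : term Sg;
  ec_bvars : seq (var Sg);
  ec_body : term Sg;
  ec_term_sorted : well_sorted ec_term;
  ec_body_constraint : is_constraint ec_body;
  ec_bvars_body : [set x | x \in ec_bvars] `<=` varset ec_body;
  ec_fvars_set : fvars (exconstr ec_bvars ec_body) `<=` ec_set;
  ec_set_term : ec_set `<=` varset ec_term;
  ec_bvars_term : [set x | x \in ec_bvars] `&` varset ec_term = set0
}.

Definition ec_constr (Sg : signature) (P : ecterm Sg) : formula Sg :=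
  exconstr (ec_bvars P) (ec_body P).

Definition ec_satisfiable (Sg : signature) (M : model Sg) (P : ecterm Sg) :
    Prop :=
  satisfiable M (ec_constr P).

Definition subsumed (Sg : signature) (M : model Sg) (P Q : ecterm Sg) : Prop :=
  forall sigma : subst Sg,
    valued (ec_set P) sigma -> satisfies M sigma (ec_constr P) ->
    exists gamma : subst Sg,
      [/\ valued (ec_set Q) gamma, satisfies M gamma (ec_constr Q)
        & tsubst sigma (ec_term P) = tsubst gamma (ec_term Q)].

Definition ec_equiv (Sg : signature) (M : model Sg) (P Q : ecterm Sg) : Prop :=
  subsumed M P Q /\ subsumed M Q P.

(* [Rule Z l r pi _ .. _] is the constrained rewrite rule Pi Z. l -> r [pi]. *)
Record rule (Sg : signature) := Rule {
  rule_set : set (var Sg);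
  lhs : term Sg;
  rhs : term Sg;
  guard : term Sg;
  lhs_sorted : well_sorted lhs;
  rhs_sorted : well_sorted rhs;
  rule_same_sort : sort_of lhs = sort_of rhs;
  guard_constraint : is_constraint guard;
  rule_setP : varset guard `|` (varset rhs `\` varset lhs) `<=` rule_set
}.

Definition left_linear (Sg : signature) (rho : rule Sg) : Prop :=
  linear_term (lhs rho).

Definition rule_vars (Sg : signature) (rho : rule Sg) : set (var Sg) :=
  varset (lhs rho) `|` varset (rhs rho) `|` varset (guard rho).

Definition exvars (Sg : signature) (rho : rule Sg) : set (var Sg) :=
  varset (rhs rho) `\` varset (lhs rho).

Definition variant (Sg : signature) (rho rho' : rule Sg) : Prop :=
  exists (tau : subst Sg) (f : var Sg -> var Sg),
    [/\ bijective f, forall x, tau x = Var (f x)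
      & [/\ rule_set rho' = f @` rule_set rho,
            lhs rho' = tsubst tau (lhs rho),
            rhs rho' = tsubst tau (rhs rho)
          & guard rho' = tsubst tau (guard rho)]].

(* the formula exists zs. pi gamma with {zs} = Var(pi) \ Var(l) *)
Definition guard_inst (Sg : signature) (rho : rule Sg) (gamma : subst Sg) :
    formula Sg :=
  exconstr [seq z <- vars (guard rho) | z \notin vars (lhs rho)]
           (tsubst gamma (guard rho)).

(* the conditions common to redexes and partial redexes *)
Definition pre_redex (Sg : signature) (M : model Sg) (P : ecterm Sg)
    (rho : rule Sg) (p : seq nat) (gamma : subst Sg) : Prop :=
  [/\ ec_satisfiable M P,
      left_linear rho
    & rule_vars rho `&` (varset (ec_term P) `|` varset (ec_body P)) = set0] /\
  [/\ subst_dom gamma = varset (lhs rho),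
      subterm_at (ec_term P) p = Some (tsubst gamma (lhs rho))
    & forall x, varset (lhs rho) x -> rule_set rho x ->
        is_val (gamma x) \/ exists2 y, ec_set P y & gamma x = Var y].

Definition redex (Sg : signature) (M : model Sg) (P : ecterm Sg)
    (rho : rule Sg) (p : seq nat) (gamma : subst Sg) : Prop :=
  pre_redex M P rho p gamma /\
  valid M (FImp (ec_constr P) (guard_inst rho gamma)).

Definition partial_redex (Sg : signature) (M : model Sg) (P : ecterm Sg)
    (rho : rule Sg) (p : seq nat) (gamma : subst Sg) : Prop :=
  pre_redex M P rho p gamma /\
  satisfiable M (FAnd (ec_constr P) (guard_inst rho gamma)).

(* [Q] is the result Pi Y. t [exists ys. psi] of contracting at [p]; the order *)
(* in which the sequence [ys] lists its elements is left open.                 *)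
Definition contractum (Sg : signature) (P : ecterm Sg) (rho : rule Sg)
    (p : seq nat) (gamma : subst Sg) (Q : ecterm Sg) : Prop :=
  [/\ ec_term Q = replace_at (ec_term P) p (tsubst gamma (rhs rho)),
      ec_body Q = tand (ec_body P) (tsubst gamma (guard rho)),
      [set y | y \in ec_bvars Q] = varset (ec_body Q) `\` varset (ec_term Q)
    & ec_set Q = exvars rho `|` (ec_set P `&` varset (ec_term Q))].

(* The disjointness of the variables of [rho'] from those of [P] is part of    *)
(* [pre_redex].                                                                *)
Definition mg_step (Sg : signature) (M : model Sg) (rho : rule Sg)
    (P Q : ecterm Sg) : Prop :=
  exists (rho' : rule Sg) (p : seq nat) (gamma : subst Sg),
    [/\ variant rho rho', redex M P rho' p gamma & contractum P rho' p gamma Q].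

Definition partial_step (Sg : signature) (M : model Sg) (rho : rule Sg)
    (P Q : ecterm Sg) : Prop :=
  exists (rho' : rule Sg) (p : seq nat) (gamma : subst Sg),
    [/\ variant rho rho', partial_redex M P rho' p gamma
      & contractum P rho' p gamma Q].

(* Main.v *)
(** Conjoin to the constraint of [P] a copy of the instantiated guard in which
    the variables [zs] occurring in the guard but not in the left-hand side are
    renamed to fresh, existentially bound ones.  The resulting term [A] is an
    instance of [P], and its constraint entails the guard, so that the partial
    step becomes a most general one.  The renaming keeps the variables of [A]
    disjoint from those of the rule.  Contracting [A] conjoins the guard a second
    time; the renamed copy is then redundant, since its bound variables can be
    given the values of the original ones. *)
From mathcomp Require Import all_boot all_classical.
Require Import Defs.

Set Implicit Arguments.
Unset Strict Implicit.
Unset Printing Implicit Defensive.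

Local Open Scope classical_set_scope.

(** The generated induction principle gives no hypothesis on the members of an argument list. Here
    it comes as a [foldr] of conjunctions, ready for induction on the list. *)
Lemma term_nested_ind (Sg : signature) (K : term Sg -> Prop) :
  (forall x, K (Var x)) ->
  (forall f ts, foldr (fun t => and (K t)) True ts -> K (App f ts)) ->
  forall t, K t.
Proof.
move=> KV KA; fix IH 1 => -[x|f ts]; first exact: KV.
by apply: KA; elim: ts => [//|t ts IHts] /=; split; first exact: IH.
Qed.

(** * Variables of instances, renamings and fresh variables *)

Section Terms.
Variable Sg : signature.
Implicit Types (t : term Sg) (s : var Sg -> term Sg) (d : var Sg -> var Sg).

Lemma vars_tsubst s t :
  vars (tsubst s t) = flatten [seq vars (s x) | x <- vars t].
Proof.
elim/term_nested_ind: t => [x|f ts IH] /=; first by rewrite cats0.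
elim: ts IH => [//|t ts IHts] /= [IHt /IHts{}IHts].
by rewrite map_cat flatten_cat IHt IHts.
Qed.

Lemma mem_vars_tsubst s t y :
  reflect (exists2 x, x \in vars t & y \in vars (s x))
          (y \in vars (tsubst s t)).
Proof. by rewrite vars_tsubst; exact: flatten_mapP. Qed.

Lemma mem_vars_rename d t y :
  reflect (exists2 x, x \in vars t & y = d x)
          (y \in vars (tsubst (Var \o d) t)).
Proof.
by apply: (iffP (mem_vars_tsubst _ _ _)) => -[x xt /=];
  rewrite ?inE => yx; exists x => //=; [apply/eqP | rewrite inE; apply/eqP].
Qed.

Lemma sort_of_rename d t : (forall x, vsort (d x) = vsort x) ->
  sort_of (tsubst (Var \o d) t) = sort_of t.
Proof. by move=> dS; case: t. Qed.

Lemma well_sorted_rename d t : (forall x, vsort (d x) = vsort x) ->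
  well_sorted (tsubst (Var \o d) t) = well_sorted t.
Proof.
move=> dS; elim/term_nested_ind: t => [//|f ts IH] /=; congr andb.
  by elim: ts IH => [//|t ts IHts] /= [IHt /IHts{}IHts]; rewrite IHt IHts.
by rewrite -map_comp (eq_map (fun t => sort_of_rename t dS)).
Qed.

Lemma theory_term_rename d t :
  theory_term (tsubst (Var \o d) t) = theory_term t.
Proof.
elim/term_nested_ind: t => [//|f ts IH] /=; congr andb.
by elim: ts IH => [//|t ts IHts] /= [IHt /IHts{}IHts]; rewrite IHt IHts.
Qed.

Lemma is_constraint_rename d t : (forall x, vsort (d x) = vsort x) ->
  is_constraint t -> is_constraint (tsubst (Var \o d) t).
Proof.
move=> dS [wt tt st]; split; rewrite ?sort_of_rename //.
  by rewrite well_sorted_rename.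
by rewrite theory_term_rename.
Qed.

Lemma is_constraint_tand t u :
  is_constraint (tand t u) <-> is_constraint t /\ is_constraint u.
Proof.
have [sT sA sR] := sandP Sg; rewrite /is_constraint /= sA sR sT !andbT /=.
split=> [[/andP[/andP[wt wu] /eqP[-> ->]] /andP[tt tu] _] // |].
by move=> [[-> -> ->] [-> -> ->]]; rewrite eqxx.
Qed.

Lemma vars_tand t u : vars (tand t u) = vars t ++ vars u.
Proof. by rewrite /= cats0. Qed.

(** Each new image avoids the earlier ones, so [d] is injective on [zs]. The left inverse [e] later
    carries values of the variables in [zs] over to their copies. *)
Lemma fresh_renaming (zs avoid : seq (var Sg)) :
  exists d e : var Sg -> var Sg,
    [/\ forall x, vsort (d x) = vsort x,
        forall x, x \notin zs -> d x = x,
        {in zs, forall x, d x \notin avoid}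
      & {in zs, cancel d e}].
Proof.
elim: zs => [|z zs [d [e [dS d_id d_fresh dK]]]]; first by exists id, id.
(* The list may repeat a variable, whose image is then already chosen. *)
have [zz|zz] := boolP (z \in zs).
  have zsE x : (x \in z :: zs) = (x \in zs).
    by rewrite inE; case: eqP => // ->; rewrite zz.
  by exists d, e; split=> // x; rewrite zsE => xz; auto.
have [z' [z'S]] := var_infinite (vsort z) (avoid ++ map d zs).
rewrite mem_cat negb_or => /andP[z'a z'd].
exists (fun x => if x == z then z' else d x),
       (fun x => if x == z' then z else e x); split=> [x|x|x|x].
- by case: eqP => [->|].
- by rewrite inE negb_or => /andP[/negPf-> /d_id].
- by rewrite inE; case: eqP => [//|_ /= /d_fresh].
- rewrite inE; case: (eqVneq x z) => [->|_ /= xz]; first by rewrite eqxx.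
  by case: eqP => [dx|_]; [rewrite -dx map_f in z'd | exact: dK].
Qed.

End Terms.

(** * Evaluation in the model, and passage from substitutions to valuations *)

Section Evaluation.
Variables (Sg : signature) (M : model Sg).
Implicit Types (a b : var Sg -> fsym Sg) (t u : term Sg).
Implicit Types (s : var Sg -> term Sg) (sigma : subst Sg) (xs : seq (var Sg)).

Lemma eq_eval a b t : {in vars t, a =1 b} -> eval M a t = eval M b t.
Proof.
elim/term_nested_ind: t => [x|f ts IH] /= ab; first by apply: ab; rewrite inE.
congr interp; elim: ts IH ab => [//|t ts IHts] /= [IHt /IHts{}IHts] ab.
by rewrite IHt ?IHts // => x xt; apply: ab; rewrite mem_cat xt ?orbT.
Qed.

Lemma eval_tsubst a s t :
  eval M a (tsubst s t) = eval M (fun x => eval M a (s x)) t.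
Proof.
elim/term_nested_ind: t => [//|f ts IH] /=.
by congr interp; elim: ts IH => [//|t ts IHts] /= [-> /IHts->].
Qed.

Lemma eval_value a t : well_sorted t -> theory_term t ->
  valuation (varset t) a ->
  value (eval M a t) /\ res (eval M a t) = sort_of t.
Proof.
elim/term_nested_ind: t => [x _ _|f ts IH /=]; first by apply; exact: mem_head.
move=> /andP[ws /eqP args] /andP[tf tts] av.
have [] : all (@value Sg) (map (eval M a) ts) /\
    map (@res Sg) (map (eval M a) ts) = map (@sort_of Sg) ts.
  elim: ts IH ws tts av {args} => [//|t ts IHts] /= [IHt IH].
  move=> /andP[wt ws] /andP[tt tts] av.
  have [|-> ->] := IHt wt tt.
    by move=> x /= xt; apply: av; rewrite /varset /= mem_cat xt.
  have [||||-> ->] // := IHts.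
  by move=> x /= xt; apply: av; rewrite /varset /= mem_cat; apply/orP; right.
by move=> vs rs; apply: interp_sort => //; rewrite rs.
Qed.

(** [interp_and] speaks only of Booleans, so both conjuncts must first be seen to evaluate to some
    [bval]; hence the hypotheses on sorts and on the valuation. *)
Lemma eval_tand a t u : is_constraint t -> is_constraint u ->
  valuation (varset (tand t u)) a ->
  eval M a (tand t u) = bval Sg true <->
  eval M a t = bval Sg true /\ eval M a u = bval Sg true.
Proof.
move=> [wt tt st] [wu tu su] av.
have [||x xt|vt rt] // := @eval_value a t.
  by apply: av; rewrite /varset /= mem_cat xt.
have [||x xu|vu ru] // := @eval_value a u.
  by apply: av; rewrite /varset /= cats0 mem_cat; apply/orP; right.
have [b1 /= e1] := bval_surj vt (etrans rt st).
have [b2 /= e2] := bval_surj vu (etrans ru su).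
rewrite e1 e2 interp_and; split=> [/bval_inj/andP[-> ->] //|].
by move=> [/bval_inj-> /bval_inj->].
Qed.

(* [bval true] is junk, returned where [sigma] is a variable. *)
Definition subst_valuation sigma (x : var Sg) : fsym Sg :=
  if sigma x is App f _ then f else bval Sg true.

Lemma valuation_subst (X : set (var Sg)) sigma :
  valued X sigma -> valuation X (subst_valuation sigma).
Proof.
move=> sX x /sX[v vv]; rewrite /subst_valuation => sv.
by rewrite sv; split=> //; have := subst_sort sigma x; rewrite sv.
Qed.

(** All free variables are replaced by values, so the instance is closed and one valuation decides
    its validity. *)
Lemma truth_fsubst_exconstr sigma xs t :
  valued (fvars (exconstr xs t)) sigma ->
  valid M (fsubst sigma (exconstr xs t)) <->
  truth M (subst_valuation sigma) (exconstr xs t).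
Proof.
move=> sv.
pose s x := if x \in xs then Var x else sigma x.
have evalE b b' : {in xs, b =1 b'} ->
    (forall x, x \notin xs -> b x = subst_valuation sigma x) ->
    eval M b' (tsubst s t) = eval M b t.
  move=> bb' bs; rewrite eval_tsubst; apply: eq_eval => x xt; rewrite /s.
  have [xxs|xxs] := boolP (x \in xs); first by rewrite /= bb'.
  have [|v vv sxv] := sv x; first by split=> //; apply/negP.
  by rewrite bs // /subst_valuation sxv /= interp_value.
split=> [/(_ (subst_valuation sigma)) []|[b [bv bs tb]] a _].
- move=> y [/mem_vars_tsubst [x xt yx] yxs]; case: yxs; move: yx.
  have [xxs|xxs] := boolP (x \in xs); first by rewrite /= inE => /eqP->.
  have [|v _ ->] // := sv x; by split=> //; apply/negP.
- by move=> b [bv bs tb]; exists b; split=> //=; rewrite -(evalE b b).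
- exists (fun x => if x \in xs then b x else a x);
    split=> [x xxs|x /negPf->//|].
    by rewrite /= in xxs; rewrite xxs; exact: bv.
  by apply: etrans tb; apply: evalE => // x /= ->.
Qed.

(** The same [sigma] serves on both sides, which reduces subsumption to an implication between
    constraints under valuations. *)
Lemma subsumed_same_term (P Q : ecterm Sg) :
  ec_set P = ec_set Q -> ec_term P = ec_term Q ->
  (forall a, valuation (ec_set P) a ->
     truth M a (ec_constr P) -> truth M a (ec_constr Q)) ->
  subsumed M P Q.
Proof.
move=> eqX eqt PQ sigma sX [sv st]; exists sigma.
have sX' : valued (ec_set Q) sigma by rewrite -eqX.
have sv' : valued (fvars (ec_constr Q)) sigma.
  by move=> x /ec_fvars_set; exact: sX'.
split=> //; last by rewrite eqt.
split=> //; apply/truth_fsubst_exconstr => //; apply: PQ.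
  exact: valuation_subst.
exact/truth_fsubst_exconstr.
Qed.

Lemma valuation_body (P : ecterm Sg) a b :
  valuation (ec_set P) a -> valuation [set x | x \in ec_bvars P] b ->
  (forall x, x \notin ec_bvars P -> b x = a x) ->
  valuation (varset (ec_body P)) b.
Proof.
move=> av bv ba x xP; have [/bv//|xb] := boolP (x \in ec_bvars P).
rewrite ba //; apply/av/ec_fvars_set; split=> //; exact/negP.
Qed.

End Evaluation.

Theorem theorem3p7 (Sg : signature) (M : model Sg) (P Q : ecterm Sg)
    (rho : rule Sg) :
  left_linear rho ->
  partial_step M rho P Q ->
  exists A B : ecterm Sg,
    subsumed M A P /\ mg_step M rho A B /\ ec_equiv M B Q.
Proof.
move=> _ [rho' [p [gamma [rhoV
  [[[Psat ll disj] [dom subt vs]] part] [Qt Qb Qx QX]]]]].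
move: part; rewrite /guard_inst.
set zs := [seq z <- _ | _]; set g := tsubst gamma (guard rho') => part.
have [Pc gc] : is_constraint (ec_body P) /\ is_constraint g.
  by apply/is_constraint_tand; rewrite -Qb; exact: ec_body_constraint.
(* The domain of [gamma] is the set of variables of the left-hand side, which [zs] avoids. *)
have zsP z : z \in zs -> gamma z = Var z.
  rewrite mem_filter => /andP[zl _]; apply: contrapT => gz.
  have : subst_dom gamma z by [].
  by rewrite dom => zl'; rewrite zl' in zl.
have zsg z : z \in zs -> z \in vars g.
  move=> zz; apply/mem_vars_tsubst; exists z; last by rewrite zsP //= inE.
  by move: zz; rewrite mem_filter => /andP[].
(* A guard variable outside [zs] occurs in the left-hand side and lies in [rule_set rho'], so
   [gamma] sends it to a value or into [ec_set P]. *)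
have gvars v : v \in vars g -> v \in zs \/ ec_set P v.
  move=> /mem_vars_tsubst[y yg vy].
  have [yl|yl] := boolP (y \in vars (lhs rho')).
    right; have [||[w _ yw]|[w wX yw]] := vs y => //.
    - by apply: rule_setP; left.
    - by rewrite yw in vy.
    - by move: vy; rewrite yw /= inE => /eqP->.
  have yz : y \in zs by rewrite mem_filter yl.
  by move: vy; rewrite zsP //= inE => /eqP->; left.
have Pbt v : v \in ec_bvars P -> v \notin vars (ec_term P).
  move=> vb; apply/negP => vt; have : set0 v by rewrite -(ec_bvars_term P).
  by [].
(* The quantifier of [P] captures no such variable: it lies in [ec_set P], hence occurs in
   [ec_term P], where nothing is bound. *)
have gNbP v : v \in vars g -> v \notin zs -> v \notin ec_bvars P.
  move=> /gvars[->//|/ec_set_term vX] _; apply/negP => /Pbt; exact/negP/negPn.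
(* Avoiding both terms lets [A] and [B] bind the copies; avoiding the rule keeps [A] disjoint from
   it; avoiding [ec_body P] and [g] lets the copies be revalued freely. *)
pose avoid := vars (ec_term P) ++ vars (ec_body P) ++ vars (ec_term Q) ++
  vars g ++ vars (lhs rho') ++ vars (rhs rho') ++ vars (guard rho').
have [d [e [dS d_id d_fresh dK]]] := fresh_renaming zs avoid.
pose g' := tsubst (Var \o d) g; pose zs' := map d zs.
have g'c : is_constraint g' by exact: is_constraint_rename.
have zs'P v : v \in zs' -> v \notin avoid.
  by move=> /mapP[z zz ->]; exact: d_fresh.
have zs'g' v : v \in zs' -> v \in vars g'.
  by move=> /mapP[z /zsg zg ->]; apply/mem_vars_rename; exists z.
have g'vars v : v \in vars g' -> v \in zs' \/ [/\ v \in vars g & v \notin zs].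
  move=> /mem_vars_rename[x xg ->]; have [xz|xz] := boolP (x \in zs).
    by left; exact: map_f.
  by right; rewrite d_id.
have Nzs' v : v \in avoid -> v \notin zs'.
  by move=> va; apply/negP => /zs'P; rewrite va.
have eval_g' b b' : {in zs, forall z, b (d z) = b' z} ->
    (forall v, v \in vars g -> v \notin zs -> b v = b' v) ->
    eval M b g' = eval M b' g.
  move=> bz bN; rewrite eval_tsubst; apply: eq_eval => v vg /=.
  by have [/bz//|vz] := boolP (v \in zs); rewrite d_id //; exact: bN.
have Ab : is_constraint (tand (ec_body P) g') by exact/is_constraint_tand.
have Ax : [set x | x \in ec_bvars P ++ zs'] `<=` varset (tand (ec_body P) g').
  move=> v; rewrite /varset /= cats0 !mem_cat => /orP[/ec_bvars_body->//|].
  by move=> /zs'g'->; rewrite orbT.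
have AX : fvars (exconstr (ec_bvars P ++ zs') (tand (ec_body P) g'))
    `<=` ec_set P.
  move=> v []; rewrite /varset /= cats0 !mem_cat => vb /negP.
  rewrite negb_or => /andP[vP vz']; case/orP: vb => [vb|/g'vars[vz|[vg vz]]].
  - by apply: ec_fvars_set; split=> //; exact/negP.
  - by rewrite vz in vz'.
  - by have [vz2|] := gvars _ vg; first rewrite vz2 in vz.
have Abt : [set x | x \in ec_bvars P ++ zs'] `&` varset (ec_term P) = set0.
  apply/seteqP; split=> // v []; rewrite /varset /= mem_cat.
  move=> /orP[/Pbt/negP//|/zs'P]; rewrite !mem_cat => /norP[/negP//].
pose A := ECTerm (ec_term_sorted P) Ab Ax AX (@ec_set_term _ P) Abt.
have Bb : is_constraint (tand (tand (ec_body P) g') g).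
  exact/is_constraint_tand.
have QbE v : (v \in vars (ec_body Q)) =
    (v \in vars (ec_body P)) || (v \in vars g).
  by rewrite Qb vars_tand mem_cat.
(* The renamed guard adds only [zs']: its other variables already occur in [g]. *)
have BbE v : (v \in vars (tand (tand (ec_body P) g') g)) =
    (v \in vars (ec_body Q)) || (v \in zs').
  rewrite !vars_tand !mem_cat QbE; apply/idP/idP.
    case/orP=> [/orP[->//|/g'vars[->|[-> _]]]|->]; by rewrite ?orbT.
  by case/orP=> [/orP[->//|->]|/zs'g'->]; rewrite ?orbT.
have Bx : [set x | x \in ec_bvars Q ++ zs'] `<=`
    varset (tand (tand (ec_body P) g') g).
  move=> v; rewrite /varset [in X in _ -> X]/mkset BbE /= mem_cat.
  by move=> /orP[/ec_bvars_body->//|->]; rewrite orbT.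
have BX : fvars (exconstr (ec_bvars Q ++ zs') (tand (tand (ec_body P) g') g))
    `<=` ec_set Q.
  move=> v [vb /negP]; rewrite mem_cat negb_or => /andP[vQ vz'].
  move: (vb : v \in vars _); rewrite BbE (negPf vz') orbF => {}vb.
  by apply: ec_fvars_set; split=> //; exact/negP.
have Bbt : [set x | x \in ec_bvars Q ++ zs'] `&` varset (ec_term Q) = set0.
  apply/seteqP; split=> // v []; rewrite /= mem_cat => /orP[vQ vt|/zs'P].
    by have : set0 v by rewrite -(ec_bvars_term Q).
  by rewrite !mem_cat => /norP[_ /norP[_ /norP[/negP]]].
pose B := ECTerm (ec_term_sorted Q) Bb Bx BX (@ec_set_term _ Q) Bbt.
have body_Nzs' v : v \in vars (ec_body P) -> v \notin zs'.
  by move=> vb; apply: Nzs'; rewrite !mem_cat vb !orbT.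
have g_Nzs' v : v \in vars g -> v \notin zs'.
  by move=> vg; apply: Nzs'; rewrite !mem_cat vg !orbT.
have zs'X (v : var Sg) b :
    (forall z, z \in zs -> value (b z) /\ res (b z) = vsort z) ->
    v \in zs' -> value (b (e v)) /\ res (b (e v)) = vsort v.
  by move=> bz /mapP[z zz ->]; rewrite dK // dS; exact: bz.
exists A, B; split; [|split].
- apply: subsumed_same_term => // a av [b [bv ba tb]].
  have vA := valuation_body (P := A) av bv ba.
  have [tP _] := (eval_tand M Pc g'c vA).1 tb.
  (* The witness for [A] also revalues [zs'], which [P] does not bind, so it is reset to [a]
     there. *)
  exists (fun v => if v \in ec_bvars P then b v else a v);
    split=> [v /= vP|v /negPf->//|].
    by rewrite vP; apply: bv; rewrite /= mem_cat vP.
  apply: etrans tP; apply: eq_eval => v vb; case: ifPn => // vP.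
  by rewrite ba //= mem_cat negb_or vP body_Nzs'.
(* [A] has the term and the variable set of [P], so the data of the partial step are reused. *)
- exists rho', p, gamma; split=> //; last first.
    split=> //=; apply/seteqP; split=> v.
      rewrite /= mem_cat => /orP[vQ|vz].
        have : [set y | y \in ec_bvars Q] v by [].
        rewrite Qx => -[vb vt]; split=> //.
        by rewrite /varset /mkset BbE; apply/orP; left.
      split; first by rewrite /varset /mkset BbE vz orbT.
      by move/zs'P: vz; rewrite !mem_cat => /norP[_ /norP[_ /norP[/negP]]].
    move=> [vb vt]; rewrite /= mem_cat.
    move: (vb : v \in vars _); rewrite BbE => /orP[{}vb|->];
      last by rewrite orbT.
    suff : [set y | y \in ec_bvars Q] v by move=> /= ->.
    by rewrite Qx.
  split; first split; first split=> //.
  + have [a av [[b1 [bv1 ba1 t1]] [b2 [bv2 ba2 t2]]]] := part.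
    (* Satisfiability of the conjunction gives separate witnesses [b1] for the bound variables of
       [P] and [b2] for [zs]. They are merged, the values of [b2] being moved to the copies through
       [e]. *)
    pose b v := if v \in zs' then b2 (e v) else
                if v \in ec_bvars P then b1 v else a v.
    have bv : valuation (varset (ec_body A)) b.
      move=> v; rewrite /varset /mkset vars_tand mem_cat /b => vb.
      case: ifPn => [|vz']; first exact: zs'X.
      case: ifPn => [|vP]; first exact: bv1.
      apply: av; case/orP: vb => [vb|/g'vars[vz|[vg vz]]].
      * by left; split=> //; exact/negP.
      * by rewrite vz in vz'.
      * by right; split=> //; exact/negP.
    exists b; first by move=> v [/bv].
    exists b; split=> //; first by move=> v /Ax/bv.
    apply/eval_tand => //; split.
      apply: etrans t1; apply: eq_eval => v vb.
      rewrite /b (negPf (body_Nzs' _ vb)).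
      by case: ifPn => // /ba1.
    apply: etrans t2; apply: eval_g' => [z zz|v vg vz]; rewrite /b.
      by rewrite map_f // dK.
    by rewrite (negPf (g_Nzs' _ vg)) (negPf (gNbP _ vg vz)) ba2.
  + apply/seteqP; split=> // v [vr].
    have va : v \in vars (lhs rho') ++ vars (rhs rho') ++ vars (guard rho').
      by rewrite !mem_cat; case: vr => [[]|] /= ->; rewrite ?orbT.
    have disjv : varset (ec_term P) v \/ varset (ec_body P) v -> False.
      by move=> vP; have : set0 v by rewrite -disj.
    case=> [vt|]; first by apply: disjv; left.
    rewrite /varset /mkset vars_tand mem_cat => /orP[vb|/g'vars[vz|[vg vz]]].
    (* A variable of the renamed guard is either a fresh copy, avoiding the rule by choice, or in
       [ec_set P], thus in [ec_term P]. *)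
    * by apply: disjv; right.
    * by move/zs'P: vz; rewrite /avoid catA catA catA mem_cat va orbT.
    * have [vz2|/ec_set_term vX] := gvars _ vg; first by rewrite vz2 in vz.
      by apply: disjv; left.
  + by [].
  + move=> a av [b [bv ba tb]].
    have vb : valuation (varset (ec_body A)) b.
      move=> v vA; have [/bv//|vx] := boolP (v \in ec_bvars A).
      by rewrite ba //; apply: av; left; split=> //; exact/negP.
    have [_ tg] := (eval_tand M Pc g'c vb).1 tb.
    (* The guard holds with each [z] in [zs] given the value of its copy in the constraint of
       [A]. *)
    exists (fun v => if v \in zs then b (d v) else a v);
      split=> [v /= vz|v /negPf->//|].
      by rewrite vz -dS; apply: bv; rewrite /= mem_cat map_f ?orbT.
    apply: etrans tg; apply/esym/eval_g' => [z ->//|v vg vz].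
    by rewrite (negPf vz) ba // mem_cat negb_or gNbP //= g_Nzs'.
- split; apply: subsumed_same_term => // a av [b [bv ba tb]].
    have vb := valuation_body (P := B) av bv ba.
    have [tA tg] := (eval_tand M Ab gc vb).1 tb.
    have vA : valuation (varset (ec_body A)) b.
      by move=> v vA; apply: vb; rewrite /varset /mkset vars_tand mem_cat;
        apply/orP; left.
    have [tP _] := (eval_tand M Pc g'c vA).1 tA.
    (* From [B] to [Q] the renamed guard is dropped and the values at [zs'] are forgotten. *)
    pose b' v := if v \in ec_bvars Q then b v else a v.
    have bb' v : v \in vars (ec_body Q) -> b' v = b v.
      rewrite /b' => vQ; case: ifPn => // vx.
      rewrite ba //= mem_cat negb_or vx /=.
      by move: vQ; rewrite QbE => /orP[/body_Nzs'|/g_Nzs'].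
    exists b'; split=> [v /= vQ|v|].
    + by rewrite /b' vQ; apply: bv; rewrite /= mem_cat vQ.
    + by rewrite /b' => /negPf->.
    rewrite /= Qb; apply/eval_tand => //.
      move=> v; rewrite -Qb => vQ; rewrite bb' //; apply: vb.
      by rewrite /varset /mkset BbE; apply/orP; left.
    split; [apply: etrans tP | apply: etrans tg]; apply: eq_eval => v vP;
      by apply: bb'; rewrite QbE vP ?orbT.
have vb := valuation_body (P := Q) av bv ba.
have tQ : eval M b (tand (ec_body P) g) = bval Sg true by rewrite -Qb.
have [tP tg] : eval M b (ec_body P) = bval Sg true /\ eval M b g = bval Sg true.
  by apply/eval_tand => //; rewrite -Qb.
(* From [Q] to [B] each copy receives the value of its original, so the renamed guard holds because
   [g] does. *)
pose b' v := if v \in zs' then b (e v) else b v.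
have bb' v : v \notin zs' -> b' v = b v by rewrite /b' => /negPf->.
have vb' : valuation (varset (ec_body B)) b'.
  move=> v; rewrite /varset /mkset BbE /b' => vB; case: ifPn => vz.
    by apply: zs'X vz => z zz; apply: vb; rewrite /varset /mkset QbE zsg ?orbT.
  by apply: vb; move: vB; rewrite (negPf vz) orbF.
exists b'; split=> [v /Bx/vb'//|v|].
  by rewrite mem_cat negb_or => /andP[vQ vz]; rewrite bb' // ba.
apply/eval_tand => //; split; last first.
  by apply: etrans tg; apply: eq_eval => v /g_Nzs'/bb'.
apply/eval_tand => //.
  by move=> v vA; apply: vb'; rewrite /varset /mkset vars_tand mem_cat;
    apply/orP; left.
split; first by apply: etrans tP; apply: eq_eval => v /body_Nzs'/bb'.
apply: etrans tg; apply: eval_g' => [z zz|v /g_Nzs'/bb'//].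
by rewrite /b' map_f // dK.
Qed.
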